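(* Let $\gamma\in[1,\infty)$, $\alpha\in(\tfrac14,1]$, $s\in\mathbb{R}$, and $\Gamma(x,t)=x-t^\alpha$ for $t\in[0,1]$. Suppose there is a constant $C$ such that for all Schwartz functions $f$ on $\mathbb{R}$, $$\Big\|\sup_{t\in[0,1]}|P_\gamma f(\Gamma(x,t),t)|\Big\|_{L^2([-1,1])}\le C\|f\|_{H^s}.$$ Then $s\ge\tfrac12(1-\tfrac1\gamma)$ if $\gamma\in[\max\{\tfrac1{2\alpha},1\},2)$, and $s\ge\tfrac14$ if $\gamma\in[2,\infty)$.
   Context: For $\gamma>0$ and $t\in[0,1]$, $$P_\gamma f(\Gamma(x,t),t)=\frac1{2\pi}\int_{\mathbb{R}}e^{i(\Gamma(x,t)\xi+t|\xi|^2)}e^{-t^\gamma|\xi|^2}\hat f(\xi)\,d\xi,$$ where $\hat f(\xi)=\int e^{-ix\xi}f(x)\,dx$, and $\|f\|_{H^s}=\|(1+|\xi|^2)^{s/2}\hat f\|_{L^2}$. *)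

(* Defs.v *)
From mathcomp Require Import all_boot all_order all_algebra.
From mathcomp Require Import all_classical all_reals all_analysis.
Set Implicit Arguments. Unset Strict Implicit. Unset Printing Implicit Defensive.
Import Order.TTheory GRing.Theory Num.Theory.
Import numFieldNormedType.Exports.
Local Open Scope classical_set_scope.
Local Open Scope ring_scope.

(* A complex-valued function f : R -> C is represented by its real part fr
   and imaginary part fi (f = fr + i fi). *)

Definition schwartz (R : realType) (f : R -> R) : Prop :=
  (forall (n : nat) (x : R), derivable (derive1n n f) x 1) /\
  (forall n k : nat, exists M : R, forall x : R, `|x| ^+ k * `|derive1n n f x| <= M).

(* Fourier transform  \hat f(xi) = \int e^{-i x xi} f(x) dx, real/imag parts. *)
Definition fourier_re (R : realType) (fr fi : R -> R) (xi : R) : R :=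
  Rintegral (@lebesgue_measure R) setT
    (fun x => cos (x * xi) * fr x + sin (x * xi) * fi x).
Definition fourier_im (R : realType) (fr fi : R -> R) (xi : R) : R :=
  Rintegral (@lebesgue_measure R) setT
    (fun x => cos (x * xi) * fi x - sin (x * xi) * fr x).

(* P_gamma f (y, t) = (1/2pi) \int e^{i(y xi + t xi^2)} e^{-t^gamma xi^2} \hat f(xi) dxi *)
Definition Pg_re (R : realType) (gamma : R) (fr fi : R -> R) (y t : R) : R :=
  (2 * pi)^-1 * Rintegral (@lebesgue_measure R) setT
    (fun xi => expR (- (t `^ gamma) * xi ^+ 2) *
       (cos (y * xi + t * xi ^+ 2) * fourier_re fr fi xi
        - sin (y * xi + t * xi ^+ 2) * fourier_im fr fi xi)).
Definition Pg_im (R : realType) (gamma : R) (fr fi : R -> R) (y t : R) : R :=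
  (2 * pi)^-1 * Rintegral (@lebesgue_measure R) setT
    (fun xi => expR (- (t `^ gamma) * xi ^+ 2) *
       (sin (y * xi + t * xi ^+ 2) * fourier_re fr fi xi
        + cos (y * xi + t * xi ^+ 2) * fourier_im fr fi xi)).

Definition Pg_abs (R : realType) (gamma : R) (fr fi : R -> R) (y t : R) : R :=
  Num.sqrt (Pg_re gamma fr fi y t ^+ 2 + Pg_im gamma fr fi y t ^+ 2).

Definition Gam (R : realType) (alpha x t : R) : R := x - t `^ alpha.

Definition maxfun (R : realType) (gamma alpha : R) (fr fi : R -> R) (x : R)
  : \bar R :=
  ereal_sup [set (Pg_abs gamma fr fi (Gam alpha x t) t)%:E | t in `[0, 1]].

Definition maxnorm (R : realType) (gamma alpha : R) (fr fi : R -> R) : \bar R :=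
  ((\int[@lebesgue_measure R]_(x in `[(-1)%R, 1%R]) (maxfun gamma alpha fr fi x ^+ 2))
     `^ (2^-1))%E.

Definition Hs_norm (R : realType) (s : R) (fr fi : R -> R) : R :=
  Num.sqrt (Rintegral (@lebesgue_measure R) setT
    (fun xi => (1 + xi ^+ 2) `^ s *
       (fourier_re fr fi xi ^+ 2 + fourier_im fr fi xi ^+ 2))).

(* Main.v *)
(** Test the estimate on wave packets [f(x) = e^{iNx} e^{-w^2 x^2/2}], whose
    Fourier transform is a Gaussian of width [w] centred at [N].  Writing
    [xi = N + eta], the phase of [P_gamma f] is a constant plus
    [(Gamma(x,t) + 2tN) eta + t eta^2].  If at some time [t = t(x)] the linear
    coefficient times [w] and the number [t w^2] are small, while
    [t^gamma N^2 <= 1], then the integral does not oscillate, nor is it damped,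
    and its size is comparable to its value without phase.  If such a time exists
    for all [x] in [[-L, 0]], comparing with [||f||_{H^s}] gives [w L <= K N^{2s}].
    Taking [t = 0] and [w = 1] yields [s >= 0].  Next let [beta = min(gamma, 2)],
    [T = N^{-2/beta}], [w] comparable to [N^{1/beta}] and [L = N T]; for
    [x] in [[-L, 0]] the equation [x - t^alpha + 2tN = 0] has a solution in
    [[0, T]] by the intermediate value theorem, because [2(1 - alpha) <= beta].
    This gives [N^{1 - 1/beta} <= K' N^{2s}] for all [N >= 1]. *)

Require Import Defs.
From mathcomp Require Import all_boot all_order all_algebra.
From mathcomp Require Import all_classical all_reals all_analysis.
From mathcomp Require Import measurable_realfun ring lra.
Import Order.TTheory GRing.Theory Num.Theory.
Import numFieldNormedType.Exports.
Local Open Scope classical_set_scope.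
Local Open Scope ring_scope.
Set Implicit Arguments. Unset Strict Implicit. Unset Printing Implicit Defensive.

(** * Gaussian integrals and domination by Gaussians *)

Section Gaussian.
Variable R : realType.
Local Notation mu := (@lebesgue_measure R).
Implicit Types (m c x : R).

Lemma normal_funE m c x : 0 < c ->
  expR (- (c * (x - m) ^+ 2)) = normal_fun m (Num.sqrt (2 * c)^-1) x.
Proof.
move=> c0; rewrite /normal_fun sqr_sqrtr ?invr_ge0 ?mulr_ge0 ?ltW//.
by congr expR; field; rewrite gt_eqF.
Qed.

(** Reduces to the normal density of variance [(2 * c)^-1], whose integrability and total mass are
    known. *)
Lemma gaussianE m c : 0 < c ->
  (fun x => expR (- (c * (x - m) ^+ 2))) =
  (fun x => Num.sqrt (pi / c) * normal_pdf m (Num.sqrt (2 * c)^-1) x).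
Proof.
move=> c0; apply/funext => x.
have s0 : Num.sqrt (2 * c)^-1 != 0 by rewrite gt_eqF// sqrtr_gt0 invr_gt0 mulr_gt0.
rewrite normal_funE// normal_pdfE//= /normal_peak mulrA.
rewrite sqr_sqrtr ?invr_ge0 ?mulr_ge0 ?ltW//.
have -> : (2 * c)^-1 * pi *+ 2 = pi / c by field; rewrite gt_eqF.
by rewrite divff ?mul1r// gt_eqF// sqrtr_gt0 divr_gt0// pi_gt0.
Qed.

Lemma integrable_gaussian m c : 0 < c ->
  mu.-integrable setT (EFin \o (fun x => expR (- (c * (x - m) ^+ 2)))).
Proof.
move=> c0; rewrite gaussianE//.
apply: (@eq_integrable _ _ _ mu _ _ (fun x => ((Num.sqrt (pi / c))%:E *
    (normal_pdf m (Num.sqrt (2 * c)^-1) x)%:E)%E)) => //.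
by apply: integrableZl => //; exact: integrable_normal_pdf.
Qed.

Lemma Rintegral_gaussian m c : 0 < c ->
  Rintegral mu setT (fun x => expR (- (c * (x - m) ^+ 2))) = Num.sqrt (pi / c).
Proof.
move=> c0; rewrite gaussianE// RintegralZl//; last exact: integrable_normal_pdf.
by rewrite /Rintegral integral_normal_pdf/= mulr1.
Qed.

Lemma integrable_gaussian_bound (f : R -> R) m c M : 0 < c ->
  measurable_fun setT f ->
  (forall x, `|f x| <= M * expR (- (c * (x - m) ^+ 2))) ->
  mu.-integrable setT (EFin \o f).
Proof.
move=> c0 mf fM.
apply: (@le_integrable _ _ _ mu _ _ (EFin \o f)
   (fun x => (M%:E * (expR (- (c * (x - m) ^+ 2)))%:E)%E)) => //.
- exact/measurable_EFinP.
- move=> x _ /=; rewrite lee_fin (le_trans (fM x))//.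
  by rewrite ler_norm.
- by apply: integrableZl => //; exact: integrable_gaussian.
Qed.

Lemma mul_expRN_le1 (u : R) : 0 <= u -> u * expR (- u) <= 1.
Proof.
move=> u0; rewrite expRN ler_pdivrMr ?expR_gt0// mul1r.
by apply: le_trans (expR_ge1Dx u); rewrite lerDr.
Qed.

End Gaussian.

(** * The integral of a derivative over the whole line *)

Section VanishingIntegral.
Variable R : realType.
Local Notation mu := (@lebesgue_measure R).

(** The integral of [f] over [[-(n+1), n+1]] is a difference of boundary values of [F], which tends
    to 0. Dominated convergence, with [|f|] as bound, identifies the limit with the full integral.
    The half-width [n.+1] keeps every interval nondegenerate. *)
Lemma Rintegral_derivative_vanishing (F f : R -> R) :
  (forall x : R, is_derive x (1 : R) F (f x)) -> continuous f ->
  mu.-integrable setT (EFin \o f) ->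
  F n.+1%:R @[n --> \oo] --> (0 : R) -> F (- n.+1%:R) @[n --> \oo] --> (0 : R) ->
  Rintegral mu setT f = 0.
Proof.
move=> dF cf intf F1 F2.
have mf : measurable_fun setT f by exact: continuous_measurable_fun.
pose I n := `[- n.+1%:R, n.+1%:R]%classic : set R.
pose f_ n x := (f \_ (I n)) x.
have f_cvg x : (f_ n x)%:E @[n --> \oo] --> (f x)%:E.
  apply: cvg_near_cst.
  near=> n; rewrite /f_ patchE mem_set// /I /= in_itv/=.
  rewrite -ler_norml (@le_trans _ _ n%:R)//; last by rewrite ler_nat.
  by near: n; exact: nbhs_infty_ger.
have := @dominated_convergence _ _ _ mu setT measurableT
  (fun n x => (f_ n x)%:E) (EFin \o f) (fun x => `|(f x)%:E|%E).
case.
- move=> n; apply/measurable_EFinP.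
  by apply: (measurable_restrictT f _).1; [exact: measurable_itv|exact: measurable_funTS].
- exact/measurable_EFinP.
- by apply: aeW => x _; exact: f_cvg.
- exact: integrable_abse.
- apply: aeW => x n _; rewrite lee_fin /f_ patchE; case: ifP => // _.
  by rewrite normr0.
move=> _ _.
have cF : continuous F.
  move=> x; apply: differentiable_continuous; apply/derivable1_diffP.
  by have [] := dF x.
have -> : [sequence (\int[mu]_(x in [set: R]) (f_ n x)%:E)%E]_n =
   (fun n => (F n.+1%:R - F (- n.+1%:R))%:E).
  apply/funext => n.
  transitivity (\int[mu]_(x in I n) (f x)%:E)%E.
    rewrite integral_mkcond; apply: eq_integral => x _.
    by rewrite /f_ !patchE; case: ifP.
  rewrite /I (@continuous_FTC2 _ f F)//.
  - by rewrite -subr_gt0 opprK addr_gt0.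
  - by apply: continuous_subspaceT.
  - split.
    + by move=> x _; have [] := dF x.
    + by apply: cvg_at_right_filter; exact: cF.
    + by apply: cvg_at_left_filter; exact: cF.
  - by move=> x _; rewrite derive1E; have [_ ->] := dF x.
move=> h.
have h0 : (F n.+1%:R - F (- n.+1%:R))%:E @[n --> \oo] --> (0 : R)%:E.
  apply: cvg_EFin; first by apply: nearW.
  by rewrite -[X in _ --> X](subr0 (0:R)); apply: cvgB.
by rewrite /Rintegral -(cvg_unique _ h0 h).
Unshelve. all: by end_near. Qed.

End VanishingIntegral.

(** * Derivative rules for functions written pointwise *)

Section PointwiseDerivatives.
Variable R : realType.
Implicit Types (f g : R -> R) (x a b : R).

(** This rule and the next ones use explicit lambdas, so that [apply:] can follow the shape of the
    function being differentiated. *)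
Lemma is_deriveD_fun f g x a b : is_derive x (1 : R) f a ->
  is_derive x (1 : R) g b -> is_derive x (1 : R) (fun y => f y + g y) (a + b).
Proof. by move=> df dg; exact: is_deriveD. Qed.

Lemma is_deriveN_fun f x a : is_derive x (1 : R) f a ->
  is_derive x (1 : R) (fun y => - f y) (- a).
Proof. by move=> df; exact: is_deriveN. Qed.

Lemma is_deriveM_fun f g x a b : is_derive x (1 : R) f a ->
  is_derive x (1 : R) g b ->
  is_derive x (1 : R) (fun y => f y * g y) (a * g x + f x * b).
Proof.
move=> df dg; have := is_deriveM df dg.
by rewrite addrC /GRing.scale/= [g x * a]mulrC.
Qed.

Lemma is_derive_comp_fun f g x a b : is_derive (g x) (1 : R) f a ->
  is_derive x (1 : R) g b -> is_derive x (1 : R) (fun y => f (g y)) (a * b).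
Proof. by move=> df dg; exact: is_derive1_comp. Qed.

Lemma is_derive_continuous f (df : R -> R) :
  (forall x, is_derive x (1 : R) f (df x)) -> continuous f.
Proof.
move=> fdf x; apply: differentiable_continuous; apply/derivable1_diffP.
by have [] := fdf x.
Qed.

Lemma is_derive_affine a b x : is_derive x (1 : R) (fun y => y * a + b) a.
Proof.
rewrite -[X in is_derive _ _ _ X](_ : (1 * a + x * 0) + 0 = a); last by ring.
apply: is_deriveD_fun; apply: is_deriveM_fun.
Qed.

Lemma is_derive_gaussian c x : is_derive x (1 : R)
  (fun y => expR (- (c * y ^+ 2))) (- (2 * c * x) * expR (- (c * x ^+ 2))).
Proof.
have sq : is_derive x (1 : R) (fun y => - (c * (y * y))) (- (2 * c * x)).
  have -> : - (2 * c * x) = - (0 * (x * x) + c * (1 * x + x * 1)) by ring.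
  by apply: is_deriveN_fun; apply: is_deriveM_fun; apply: is_deriveM_fun.
rewrite mulrC; apply: (@is_derive_comp_fun expR (fun y => - (c * y ^+ 2))).
Qed.

End PointwiseDerivatives.

(** * Fourier transform of a Gaussian *)

Section FourierGaussian.
Variable R : realType.
Local Notation mu := (@lebesgue_measure R).
Implicit Types (c x z phi : R).

(** Half of the exponent absorbs [x ^+ 2]: apply [u * expR (- u) <= 1] to [u = c / 2 * x ^+ 2]. *)
Lemma sqr_mul_gaussian_le c x : 0 < c ->
  x ^+ 2 * expR (- (c * x ^+ 2)) <= 2 / c * expR (- (c / 2 * x ^+ 2)).
Proof.
move=> c0; have c20 : 0 < c / 2 by rewrite divr_gt0.
have -> : - (c * x ^+ 2) = - (c / 2 * x ^+ 2) - (c / 2 * x ^+ 2) by field.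
rewrite expRD mulrA ler_wpM2r ?expR_ge0//.
have /mul_expRN_le1 : 0 <= c / 2 * x ^+ 2 by rewrite mulr_ge0 ?sqr_ge0 ?ltW.
rewrite -mulrA -ler_pdivlMl// mulr1 => /le_trans; apply.
by rewrite invf_div.
Qed.

Lemma gaussian_le c x : 0 <= c -> expR (- (c * x ^+ 2)) <= expR (- (c / 2 * x ^+ 2)).
Proof.
move=> c0; rewrite ler_expR lerN2 ler_wpM2r ?sqr_ge0//; lra.
Qed.

Lemma integrable_quadratic_gaussian (f : R -> R) c (A B : R) : 0 < c -> 0 <= A -> 0 <= B ->
  measurable_fun setT f -> (forall x, `|f x| <= A + B * x ^+ 2) ->
  mu.-integrable setT (EFin \o (fun x => f x * expR (- (c * x ^+ 2)))).
Proof.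
move=> c0 A0 B0 mf fAB.
apply: (@integrable_gaussian_bound _ _ 0 (c / 2) (A + B * (2 / c))).
- by rewrite divr_gt0.
- apply: measurable_funM => //; apply: measurableT_comp => //.
  apply: measurableT_comp => //; apply: measurable_funM.
  + exact: measurable_cst.
  + exact: exprn_measurable.
- move=> x; rewrite subr0 normrM (ger0_norm (expR_ge0 _)).
  rewrite (le_trans (ler_wpM2r (expR_ge0 _) (fAB x)))// !(mulrDl A) lerD//.
    by rewrite ler_wpM2l// gaussian_le// ltW.
  by rewrite -!(mulrA B) ler_wpM2l// sqr_mul_gaussian_le.
Qed.

Lemma integrable_scale (f : R -> R) (k : R) :
  mu.-integrable setT (EFin \o f) -> mu.-integrable setT (EFin \o (fun x => k * f x)).
Proof. by move=> intf; exact: (integrableZl measurableT k intf). Qed.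

(** Since [expR v >= v], the Gaussian bound is at most [c^-1 / (n + 1)], a multiple of the harmonic
    sequence. *)
Lemma gaussian_bounded_cvg0 c (u : nat -> R) : 0 < c ->
  (forall n, `|u n| <= expR (- (c * n.+1%:R ^+ 2))) -> u n @[n --> \oo] --> (0 : R).
Proof.
move=> c0 uc; apply: norm_cvg0.
have h0 : c^-1 * harmonic n @[n --> \oo] --> (0 : R).
  by rewrite -(mulr0 c^-1); apply: cvgMr; exact: cvg_harmonic.
apply: (@squeeze_cvgr _ _ _ _ (cst 0) _ _ _ _ _ h0); last exact: cvg_cst.
apply: nearW => n /=; rewrite normr_ge0/= (le_trans (uc n))//.
rewrite expRN -invfM lef_pV2 ?posrE ?expR_gt0 ?mulr_gt0//.
apply: le_trans (expR_ge1Dx _).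
rewrite (@le_trans _ _ (c * n.+1%:R ^+ 2))//; last by rewrite lerDr.
by rewrite ler_pM2l// expr2 ler_peMl// ler1n.
Qed.

(* The integral [H] satisfies [H' = - z/(2c) H]: differentiate under the integral
   sign, then integrate by parts. *)
Lemma Rintegral_cos_gaussian c z phi : 0 < c ->
  Rintegral mu setT (fun x => cos (x * z + phi) * expR (- (c * x ^+ 2))) =
  cos phi * Num.sqrt (pi / c) * expR (- (z ^+ 2 / (4 * c))).
Proof.
move=> c0.
pose H z := Rintegral mu setT (fun x => cos (x * z + phi) * expR (- (c * x ^+ 2))).
pose S z := Rintegral mu setT (fun x => x * sin (x * z + phi) * expR (- (c * x ^+ 2))).
have mlin y : measurable_fun setT (fun x : R => x * y + phi).
  by apply: measurable_funD => //; apply: measurable_funM.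
have mcos y : measurable_fun setT (fun x : R => cos (x * y + phi)).
  apply: measurableT_comp => //; apply: continuous_measurable_fun; exact: continuous_cos.
have msin y : measurable_fun setT (fun x : R => sin (x * y + phi)).
  apply: measurableT_comp => //; apply: continuous_measurable_fun; exact: continuous_sin.
have intH y : mu.-integrable setT
    (EFin \o (fun x => cos (x * y + phi) * expR (- (c * x ^+ 2)))).
  apply: (@integrable_quadratic_gaussian _ _ 1 0) => // x.
  by rewrite mul0r addr0 cos_max.
have xle (x : R) : `|x| <= 1 + x ^+ 2.
  by rewrite -real_normK ?num_real//; nra.
have intS y : mu.-integrable setT
    (EFin \o (fun x => x * sin (x * y + phi) * expR (- (c * x ^+ 2)))).
  apply: (@integrable_quadratic_gaussian _ _ 1 1) => //; first exact: measurable_funM.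
  move=> x; rewrite mul1r normrM (le_trans _ (xle x))// ler_piMr//.
  exact: sin_max.
have dcos (x y : R) : is_derive y (1 : R)
    (fun y => cos (x * y + phi) * expR (- (c * x ^+ 2)))
    (- (x * sin (x * y + phi) * expR (- (c * x ^+ 2)))).
  have -> : - (x * sin (x * y + phi) * expR (- (c * x ^+ 2))) =
    (- sin (x * y + phi) * x) * expR (- (c * x ^+ 2)) +
    cos (x * y + phi) * 0 by ring.
  apply: is_deriveM_fun; apply: (@is_derive_comp_fun _ cos (fun y => x * y + phi)).
  by under eq_fun do rewrite mulrC; exact: is_derive_affine.
(* For every value of the parameter, [|x| * expR (- (c * x ^+ 2))] dominates the derivative of the
   integrand; the unit window around [y] is an arbitrary choice. *)
have dH y : is_derive y (1 : R) H (- S y).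
  have Iy : `]y - 1, y + 1[%classic y by rewrite /= in_itv/=; apply/andP; split; lra.
  pose h y x := cos (x * y + phi) * expR (- (c * x ^+ 2)).
  have d1h x t : partial1of2 h t x = - (x * sin (x * t + phi) * expR (- (c * x ^+ 2))).
    by rewrite partial1of2E; have [_ ->] := dcos x t.
  have derh (a x : R) : `]y - 1, y + 1[%classic a -> setT x -> derivable (h ^~ x) a 1.
    by move=> _ _; have [] := dcos x a.
  have G0 x : 0 <= `|x| * expR (- (c * x ^+ 2)) by rewrite mulr_ge0// expR_ge0.
  have intG : mu.-integrable setT (EFin \o (fun x => `|x| * expR (- (c * x ^+ 2)))).
    by apply: (@integrable_quadratic_gaussian _ _ 1 1) => // x; rewrite normr_id mul1r.
  have Gub (a x : R) : `]y - 1, y + 1[%classic a -> setT x ->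
      `|partial1of2 h a x| <= `|x| * expR (- (c * x ^+ 2)).
    move=> _ _; rewrite d1h normrN !normrM (ger0_norm (expR_ge0 _)).
    by rewrite ler_wpM2r ?expR_ge0// ler_piMr// sin_max.
  apply: DeriveDef.
    exact: (@derivable_under_integral _ _ _ mu h setT measurableT y _ _ Iy
      (fun a _ => intH a) derh _ G0 intG Gub).
  rewrite -derive1E (@differentiation_under_integral _ _ _ mu h setT measurableT y _ _ Iy
      (fun a _ => intH a) derh _ G0 intG Gub).
  under eq_Rintegral do rewrite d1h -mulN1r.
  by rewrite RintegralZl// mulN1r.
(* The difference of the two sides is the integral of the derivative of [sin (x * y + phi) * expR (-
   (c * x ^+ 2))]. *)
have HS y : y * H y = 2 * c * S y.
  apply/eqP; rewrite -subr_eq0 -RintegralZl// -RintegralZl//; apply/eqP.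
  rewrite -RintegralB//; last 2 first.
  - exact: integrable_scale.
  - exact: integrable_scale.
  apply: (@Rintegral_derivative_vanishing _
    (fun x => sin (x * y + phi) * expR (- (c * x ^+ 2)))).
  - move=> x.
    have -> : y * (cos (x * y + phi) * expR (- (c * x ^+ 2))) -
       2 * c * (x * sin (x * y + phi) * expR (- (c * x ^+ 2))) =
       (cos (x * y + phi) * y) * expR (- (c * x ^+ 2)) +
       sin (x * y + phi) * (- (2 * c * x) * expR (- (c * x ^+ 2))) by ring.
    apply: is_deriveM_fun; last exact: is_derive_gaussian.
    apply: (@is_derive_comp_fun _ sin (fun x => x * y + phi)).
    exact: is_derive_affine.
  - have cc : continuous (fun x : R => cos (x * y + phi)).
      apply: (is_derive_continuous (df := fun x => - sin (x * y + phi) * y)) => x.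
      by apply: (@is_derive_comp_fun _ cos (fun x => x * y + phi)); exact: is_derive_affine.
    have cs : continuous (fun x : R => sin (x * y + phi)).
      apply: (is_derive_continuous (df := fun x => cos (x * y + phi) * y)) => x.
      by apply: (@is_derive_comp_fun _ sin (fun x => x * y + phi)); exact: is_derive_affine.
    have cg : continuous (fun x : R => expR (- (c * x ^+ 2))).
      by apply: is_derive_continuous => x; exact: is_derive_gaussian.
    move=> x; apply: cvgB; apply: cvgM; try exact: cvg_cst.
      by apply: cvgM; [exact: cc|exact: cg].
    by apply: cvgM; [apply: cvgM; [exact: cvg_id|exact: cs]|exact: cg].
  - exact: (integrableB measurableT (integrable_scale y (intH y))
      (integrable_scale (2 * c) (intS y))).
  - apply: (gaussian_bounded_cvg0 c0) => n.
    rewrite normrM (ger0_norm (expR_ge0 _)) ler_piMl ?expR_ge0//; exact: sin_max.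
  - apply: (gaussian_bounded_cvg0 c0) => n.
    rewrite normrM (ger0_norm (expR_ge0 _)) sqrrN ler_piMl ?expR_ge0//; exact: sin_max.
(* The integrating factor is [expR (y ^+ 2 / (4 * c))], written as a Gaussian with negative
   coefficient so that [is_derive_gaussian] applies. *)
have dHy y : is_derive y (1 : R) (fun y => H y * expR (- (- (4 * c)^-1 * y ^+ 2))) 0.
  have -> : 0 = (- S y) * expR (- (- (4 * c)^-1 * y ^+ 2)) +
     H y * (- (2 * (- (4 * c)^-1) * y) * expR (- (- (4 * c)^-1 * y ^+ 2))).
    rewrite [H y * _]mulrA -mulrDl.
    have -> : H y * - (2 * - (4 * c)^-1 * y) = (2 * c)^-1 * (y * H y).
      by field; rewrite gt_eqF.
    by rewrite HS mulrA mulVf ?mul1r ?addNr ?mul0r// gt_eqF// mulr_gt0.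
  by apply: is_deriveM_fun; exact: is_derive_gaussian.
have := is_derive_0_is_cst z 0 dHy.
have -> : H 0 = cos phi * Num.sqrt (pi / c).
  rewrite /H; under eq_Rintegral do rewrite mulr0 add0r.
  rewrite RintegralZl//.
    by rewrite -(Rintegral_gaussian 0 c0); under [in RHS]eq_Rintegral do rewrite subr0.
  have := integrable_gaussian 0 c0; apply: eq_integrable => // x _ /=.
  by rewrite subr0.
rewrite expr0n mulr0 oppr0 expR0 mulr1 mulNr opprK => <-.
by rewrite -mulrA -expRD mulrC [z ^+ 2 / _]mulrC subrr expR0 mul1r.
Qed.
End FourierGaussian.

(** * Modulated Gaussians are Schwartz functions *)

Section SchwartzGaussian.
Variable R : realType.
Implicit Types (p q : {poly R}) (a b c x : R).

(** A family that contains the modulated Gaussians and is closed under differentiation, so that one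
    bound covers all derivatives. *)
Definition poly_gaussian a b c p q x : R :=
  (p.[x] * cos (x * a + b) + q.[x] * sin (x * a + b)) * expR (- (c * x ^+ 2)).

Lemma is_derive_poly_gaussian a b c p q x : is_derive x (1 : R) (poly_gaussian a b c p q)
  (poly_gaussian a b c (p^`() + a *: q - (2 * c) *: ('X * p))
                       (q^`() - a *: p - (2 * c) *: ('X * q)) x).
Proof.
set C := cos (x * a + b); set S := sin (x * a + b); set g := expR (- (c * x ^+ 2)).
have h : is_derive x (1 : R) (poly_gaussian a b c p q)
    (((p^`().[x] * C + p.[x] * (- S * a)) + (q^`().[x] * S + q.[x] * (C * a))) * g +
    (p.[x] * C + q.[x] * S) * (- (2 * c * x) * g)); last first.
  by apply: (is_derive_eq h); rewrite /poly_gaussian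
    !(hornerD, hornerN, hornerZ, hornerM, hornerX) -/C -/S -/g; ring.
apply: is_deriveM_fun; last exact: is_derive_gaussian.
apply: is_deriveD_fun; apply: is_deriveM_fun.
  apply: (@is_derive_comp_fun _ cos (fun x => x * a + b)); exact: is_derive_affine.
apply: (@is_derive_comp_fun _ sin (fun x => x * a + b)); exact: is_derive_affine.
Qed.

Lemma derive1n_poly_gaussian a b c p q n :
  exists p' q', derive1n n (poly_gaussian a b c p q) = poly_gaussian a b c p' q'.
Proof.
elim: n => [|n [p' [q' IH]]]; first by exists p, q.
exists (p'^`() + a *: q' - (2 * c) *: ('X * p')), (q'^`() - a *: p' - (2 * c) *: ('X * q')).
rewrite derive1nS IH; apply/funext => x; rewrite derive1E.
by have [_ ->] := is_derive_poly_gaussian a b c p' q' x.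
Qed.

Lemma power_gaussian_bounded c k : 0 < c ->
  exists M, forall x, `|x| ^+ k * expR (- (c * x ^+ 2)) <= M.
Proof.
(* The summands match [|x| ^+ k <= 1 + x ^+ (2 * (k + 1))]; the second power is controlled by the
   term of degree [k + 1] in the exponential series at [c * x ^+ 2]. *)
move=> c0; exists (1 + k.+1`!%:R / c ^+ k.+1) => x.
have cx0 : 0 <= c * x ^+ 2 by rewrite mulr_ge0 ?sqr_ge0 ?ltW.
have ck0 : 0 < c ^+ k.+1 by rewrite exprn_gt0.
rewrite expRN ler_pdivrMr ?expR_gt0//.
have h1 : `|x| ^+ k <= 1 + (x ^+ 2) ^+ k.+1.
  rewrite -real_normK ?num_real// -exprM.
  have [x1|/ltW x1] := leP `|x| 1.
    by rewrite (@le_trans _ _ 1) ?exprn_ile1// lerDl exprn_ge0.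
  apply: (@le_trans _ _ (`|x| ^+ (2 * k.+1))); last by rewrite lerDr.
  by rewrite ler_weXn2l// mul2n -addnn (leq_trans (leqnSn k))// leq_addr.
apply: (le_trans h1); rewrite mulrDl mul1r lerD//.
  by rewrite -expR0 ler_expR.
have := expR_ge1Dxn k cx0.
move=> /(le_trans _) h.
have {h} : (c * x ^+ 2) ^+ k.+1 / k.+1`!%:R <= expR (c * x ^+ 2).
  by apply: h; rewrite lerDr.
rewrite ler_pdivrMr ?ltr0n ?fact_gt0// exprMn => h.
by rewrite mulrAC ler_pdivlMr// mulrC (le_trans h)// mulrC.
Qed.

Lemma poly_gaussian_bounded c p k : 0 < c ->
  exists M, forall x, `|x| ^+ k * (`|p.[x]| * expR (- (c * x ^+ 2))) <= M.
Proof.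
(* [k] stays general: the factor [x] in [p.[x] * x + r] is moved into the power of [|x|]. *)
move=> c0; elim/poly_ind: p k => [|p r IH] k.
  by exists 0 => x; rewrite horner0 normr0 mul0r mulr0.
have [M1 h1] := IH k.+1; have [M2 h2] := power_gaussian_bounded k c0.
exists (M1 + `|r| * M2) => x; rewrite hornerMXaddC.
have h : `|p.[x] * x + r| <= `|x| * `|p.[x]| + `|r|.
  by rewrite (le_trans (ler_normD _ _))// normrM mulrC.
apply: (@le_trans _ _ (`|x| ^+ k * ((`|x| * `|p.[x]| + `|r|) * expR (- (c * x ^+ 2))))).
  by rewrite ler_wpM2l ?exprn_ge0// ler_wpM2r ?expR_ge0.
have -> : `|x| ^+ k * ((`|x| * `|p.[x]| + `|r|) * expR (- (c * x ^+ 2))) =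
  `|x| ^+ k.+1 * (`|p.[x]| * expR (- (c * x ^+ 2))) +
  `|r| * (`|x| ^+ k * expR (- (c * x ^+ 2))) by rewrite (exprS _ k); ring.
by rewrite lerD// ler_wpM2l.
Qed.

Lemma schwartz_poly_gaussian a b c p q : 0 < c -> schwartz (poly_gaussian a b c p q).
Proof.
move=> c0; split=> [n x|n k].
  have [p' [q' ->]] := derive1n_poly_gaussian a b c p q n.
  by have [] := is_derive_poly_gaussian a b c p' q' x.
have [p' [q' ->]] := derive1n_poly_gaussian a b c p q n.
have [M1 h1] := poly_gaussian_bounded p' k c0.
have [M2 h2] := poly_gaussian_bounded q' k c0.
exists (M1 + M2) => x.
apply: le_trans (lerD (h1 x) (h2 x)).
rewrite -mulrDr -mulrDl ler_wpM2l ?exprn_ge0// normrM (ger0_norm (expR_ge0 _)).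
rewrite ler_wpM2r ?expR_ge0// (le_trans (ler_normD _ _))// !normrM.
by rewrite lerD// ler_piMr// ?cos_max ?sin_max.
Qed.

Lemma schwartz_cos_gaussian a b c : 0 < c ->
  schwartz (fun x => cos (x * a + b) * expR (- (c * x ^+ 2))).
Proof.
move=> /(schwartz_poly_gaussian a b 1 0); congr (schwartz _).
by apply/funext => x; rewrite /poly_gaussian hornerC horner0 mul1r mul0r addr0.
Qed.

End SchwartzGaussian.

(** * Wave packets and their Sobolev norms *)

Section WavePacket.
Variable R : realType.
Local Notation mu := (@lebesgue_measure R).
Implicit Types (N w x xi s t y : R).

Lemma normr_sin_le x : `|sin x| <= `|x|.
Proof.
wlog x0 : x / 0 <= x => [h|].
  have [/h//|/ltW x0] := leP 0 x.
  by rewrite -normrN -sinN -(normrN x) h// oppr_ge0.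
have cs : {within `[0, x], continuous (@sin R)}.
  by apply: continuous_subspaceT; exact: continuous_sin.
have [c _] := MVT_segment x0 (fun z _ => is_derive_sin z) cs.
rewrite sin0 !subr0 => ->; rewrite normrM ler_piMl//; exact: cos_max.
Qed.

Lemma cos_ge_parabola x : 1 - x ^+ 2 / 2 <= cos x.
Proof.
have -> : cos x = 1 - 2 * sin (x / 2) ^+ 2.
  have {1}-> : x = (x / 2) *+ 2 by rewrite -mulr_natr divfK.
  by rewrite cos_mulr2n cos2sin2 -mulr_natr; ring.
have := normr_sin_le (x / 2).
rewrite -(ler_pXn2r (_ : 0 < 2)%N) ?nnegrE// !real_normK ?num_real// => h.
rewrite lerD2l lerN2; move: h; rewrite exprMn => h; lra.
Qed.

(* [packet_re + i packet_im = e^{iNx} e^{-w^2 x^2/2}]; the sine is written as a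
   shifted cosine so that statements about [cos (x * a + b)] cover both parts. *)
Definition packet_re N w x := cos (x * N + 0) * expR (- (w ^+ 2 / 2 * x ^+ 2)).
Definition packet_im N w x :=
  cos (x * N + - (pi / 2)) * expR (- (w ^+ 2 / 2 * x ^+ 2)).
(** For [w > 0], the peak value [sqrt (2 * pi) / w] of the Fourier transform of the packet. *)
Definition packet_amp w : R := Num.sqrt (pi / (w ^+ 2 / 2)).

Lemma packet_amp_gt0 w : 0 < w -> 0 < packet_amp w.
Proof.
by move=> w0; rewrite sqrtr_gt0 divr_gt0 ?pi_gt0// divr_gt0// exprn_gt0.
Qed.

Lemma fourier_re_packet N w xi : 0 < w ->
  fourier_re (packet_re N w) (packet_im N w) xi =
  packet_amp w * expR (- ((2 * w ^+ 2)^-1 * (xi - N) ^+ 2)).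
Proof.
move=> w0; have c0 : 0 < w ^+ 2 / 2 by rewrite divr_gt0// exprn_gt0.
rewrite /fourier_re.
transitivity (Rintegral mu setT
    (fun x => cos (x * (xi - N) + 0) * expR (- (w ^+ 2 / 2 * x ^+ 2)))).
  apply: eq_Rintegral => x _; rewrite /packet_re /packet_im cosBpihalf !addr0.
  by rewrite mulrBr cosB; ring.
rewrite Rintegral_cos_gaussian// cos0 mul1r; congr (_ * expR (- _)).
by field; rewrite gt_eqF.
Qed.

Lemma fourier_im_packet N w xi : 0 < w ->
  fourier_im (packet_re N w) (packet_im N w) xi = 0.
Proof.
move=> w0; have c0 : 0 < w ^+ 2 / 2 by rewrite divr_gt0// exprn_gt0.
rewrite /fourier_im.
transitivity (Rintegral mu setT
    (fun x => cos (x * (N - xi) + - (pi / 2)) * expR (- (w ^+ 2 / 2 * x ^+ 2)))).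
  apply: eq_Rintegral => x _; rewrite /packet_re /packet_im !cosBpihalf !addr0.
  by rewrite mulrBr sinB; ring.
by rewrite Rintegral_cos_gaussian// cosN cos_pihalf !mul0r.
Qed.

Lemma schwartz_packet_re N w : 0 < w -> schwartz (packet_re N w).
Proof. by move=> w0; apply: schwartz_cos_gaussian; rewrite divr_gt0// exprn_gt0. Qed.

Lemma schwartz_packet_im N w : 0 < w -> schwartz (packet_im N w).
Proof. by move=> w0; apply: schwartz_cos_gaussian; rewrite divr_gt0// exprn_gt0. Qed.

(** The squared transform carries two Gaussian factors. One absorbs the growth of the weight, as
    [(1 + 2 * v) * expR (- v) <= 2] for [v = (xi - N) ^+ 2 / (2 * w ^+ 2)]; the other integrates to
    [sqrt (2 * pi) * w]. *)
Lemma Hs_norm_packet_le s N w A : 0 < w -> 0 <= A ->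
  (forall xi, (1 + xi ^+ 2) `^ s <= A * (1 + (xi - N) ^+ 2 / w ^+ 2)) ->
  Hs_norm s (packet_re N w) (packet_im N w) ^+ 2 <=
    packet_amp w ^+ 2 * (2 * A * Num.sqrt (2 * pi) * w).
Proof.
move=> w0 A0 hA; have w20 : 0 < w ^+ 2 by rewrite exprn_gt0.
have b0 : 0 < (2 * w ^+ 2)^-1 by rewrite invr_gt0 mulr_gt0.
have c0 : 0 < (w ^+ 2)^-1 by rewrite invr_gt0.
pose a := packet_amp w.
pose g xi := expR (- ((2 * w ^+ 2)^-1 * (xi - N) ^+ 2)).
rewrite /Hs_norm sqr_sqrtr; last first.
  by apply: Rintegral_ge0 => x _; rewrite mulr_ge0 ?powR_ge0// addr_ge0 ?sqr_ge0.
have -> : packet_amp w ^+ 2 * (2 * A * Num.sqrt (2 * pi) * w) =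
    Rintegral mu setT (fun xi => a ^+ 2 * 2 * A * g xi).
  rewrite RintegralZl//; last exact: integrable_gaussian.
  rewrite Rintegral_gaussian// invrK.
  have -> : pi * (2 * w ^+ 2) = 2 * pi * w ^+ 2 :> R by ring.
  rewrite (sqrtrM (w ^+ 2)) ?mulr_ge0 ?pi_ge0// sqrtr_sqr gtr0_norm// /a; ring.
pose h xi := (1 + xi ^+ 2) `^ s * (a * g xi) ^+ 2.
have -> : Rintegral mu setT (fun xi => (1 + xi ^+ 2) `^ s *
    (fourier_re (packet_re N w) (packet_im N w) xi ^+ 2 +
     fourier_im (packet_re N w) (packet_im N w) xi ^+ 2)) = Rintegral mu setT h.
  apply: eq_Rintegral => xi _.
  by rewrite fourier_re_packet// fourier_im_packet// expr0n addr0.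
have hle xi : h xi <= a ^+ 2 * 2 * A * g xi.
  have hg : (1 + (xi - N) ^+ 2 / w ^+ 2) * g xi <= 2.
    rewrite /g expRN ler_pdivrMr ?expR_gt0//.
    have := expR_ge1Dx ((2 * w ^+ 2)^-1 * (xi - N) ^+ 2).
    have -> : (2 * w ^+ 2)^-1 * (xi - N) ^+ 2 = (xi - N) ^+ 2 / w ^+ 2 / 2.
      by field; rewrite gt_eqF.
    have : 0 <= (xi - N) ^+ 2 / w ^+ 2 by rewrite divr_ge0 ?sqr_ge0// ltW.
    lra.
  apply: (le_trans (ler_wpM2r (sqr_ge0 (a * g xi)) (hA xi))).
  have -> : a ^+ 2 * 2 * A * g xi = a ^+ 2 * A * g xi * 2 by ring.
  have -> : A * (1 + (xi - N) ^+ 2 / w ^+ 2) * (a * g xi) ^+ 2 =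
    a ^+ 2 * A * g xi * ((1 + (xi - N) ^+ 2 / w ^+ 2) * g xi) by ring.
  by rewrite ler_wpM2l// mulr_ge0 ?expR_ge0// mulr_ge0// sqr_ge0.
have h0 xi : 0 <= h xi by rewrite mulr_ge0 ?powR_ge0 ?sqr_ge0.
apply: le_Rintegral => //.
- apply: (@integrable_gaussian_bound _ _ N (2 * w ^+ 2)^-1 (a ^+ 2 * 2 * A)) => //.
    apply: measurable_funM.
      apply: measurableT_comp (measurable_powR s) _.
      by apply: measurable_funD => //; exact: exprn_measurable.
    apply: measurable_funX; apply: measurable_funM => //.
    by have /measurable_int/measurable_EFinP := integrable_gaussian N b0.
  by move=> xi; rewrite (ger0_norm (h0 xi)); exact: hle.
- by apply: integrable_scale; exact: integrable_gaussian.
- by move=> xi _; exact: hle.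
Qed.

End WavePacket.

(** * Lower bound for the evolved packet *)

Section PacketLowerBound.
Variable R : realType.
Local Notation mu := (@lebesgue_measure R).
Implicit Types (N w d xi s t y : R).

(* The integral over [u] of the lower bound of [packet_integrand_ge], where
   [u = eta / w]; positive once [d] is small. *)
Definition packet_gain d : R :=
  expR (-2) * Num.sqrt (2 * pi / 5) - 128 * d ^+ 2 * Num.sqrt pi.

Lemma packet_gain_gt0 : exists2 d : R, 0 < d <= 1 & 0 < packet_gain d.
Proof.
(* The gain vanishes when [d ^+ 2 = r]; the choice below gives [d ^+ 2 <= d < r]. *)
pose r : R := expR (-2) * Num.sqrt (2 * pi / 5) / (128 * Num.sqrt pi).
have p0 : 0 < Num.sqrt pi :> R by rewrite sqrtr_gt0 pi_gt0.
have r0 : 0 < r.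
  rewrite divr_gt0 ?mulr_gt0 ?expR_gt0 ?sqrtr_gt0 ?divr_gt0 ?mulr_gt0 ?pi_gt0//.
exists (Num.min 1 (r / 2)).
  by rewrite lt_min ltr01 divr_gt0//= ge_min lexx.
set d := Num.min 1 (r / 2).
have d0 : 0 < d by rewrite lt_min ltr01 divr_gt0.
have d1 : d <= 1 by rewrite ge_min lexx.
have dr : d <= r / 2 by rewrite ge_min lexx orbT.
have d2r : d ^+ 2 < r.
  rewrite (@le_lt_trans _ _ d)//; last lra.
  by rewrite expr2 ler_piMl// ltW.
rewrite /packet_gain subr_gt0 mulrAC.
by rewrite -ltr_pdivlMl ?mulr_gt0// mulrC.
Qed.

(** Follows from [expR v >= (1 + v / 2) ^+ 2]. At [v = u / 4] the polynomial becomes [u + u ^+ 2],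
    the error left by the cosine bound. *)
Lemma modulated_gaussian_le (v : R) : 0 <= v ->
  (4 * v + 16 * v ^+ 2) * expR (- (2 * v)) <= 64 * expR (- v).
Proof.
move=> v0.
have -> : - (2 * v) = - v - v by ring.
rewrite expRD mulrA ler_wpM2r ?expR_ge0// expRN ler_pdivrMr ?expR_gt0//.
have -> : v = v / 2 + v / 2 by field.
rewrite expRD; have := expR_ge1Dx (v / 2); nra.
Qed.

(* With [u = (eta / w)^2], the damping is at least [e^{-2-2u}], and
   [cos v >= 1 - v^2/2] with [v^2/2 <= d^2 (u + u^2)]. *)
Lemma packet_integrand_ge (tg : R) N w d t a eta : 0 < w -> w <= N ->
  0 <= tg -> tg * N ^+ 2 <= 1 -> `|a| * w <= d -> 0 <= t -> t * w ^+ 2 <= d ->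
  expR (-2) * expR (- ((5 / 2 / w ^+ 2) * eta ^+ 2)) -
    64 * d ^+ 2 * expR (- ((4 * w ^+ 2)^-1 * eta ^+ 2)) <=
  expR (- tg * (N + eta) ^+ 2) * cos (a * eta + t * eta ^+ 2) *
    expR (- ((2 * w ^+ 2)^-1 * eta ^+ 2)).
Proof.
move=> w0 wN tg0 tgN awd t0 twd.
have N0 : 0 < N by exact: lt_le_trans wN.
have w20 : 0 < w ^+ 2 by rewrite exprn_gt0.
have d0 : 0 <= d by rewrite (le_trans _ awd)// mulr_ge0// ltW.
pose u := (eta / w) ^+ 2.
have etaE : eta ^+ 2 = w ^+ 2 * u by rewrite /u; field; rewrite gt_eqF.
have u0 : 0 <= u by rewrite sqr_ge0.
have -> : 5 / 2 / w ^+ 2 * eta ^+ 2 = 5 / 2 * u by rewrite etaE; field; rewrite gt_eqF.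
have -> : (4 * w ^+ 2)^-1 * eta ^+ 2 = u / 4 by rewrite etaE; field; rewrite gt_eqF.
have -> : (2 * w ^+ 2)^-1 * eta ^+ 2 = u / 2 by rewrite etaE; field; rewrite gt_eqF.
set E := expR (- tg * (N + eta) ^+ 2).
have E1 : E <= 1.
  by rewrite -expR0 ler_expR mulNr oppr_le0 mulr_ge0 ?sqr_ge0.
have E0 : 0 <= E by exact: expR_ge0.
(* Use [(N + eta) ^+ 2 <= 2 * N ^+ 2 + 2 * eta ^+ 2] and [tg * w ^+ 2 <= tg * N ^+ 2 <= 1]. *)
have E2 : expR (-2 - 2 * u) <= E.
  rewrite ler_expR mulNr -opprD lerN2.
  have h1 : (N + eta) ^+ 2 <= 2 * N ^+ 2 + 2 * eta ^+ 2.
    have := sqr_ge0 (N - eta); nra.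
  apply: (le_trans (ler_wpM2l tg0 h1)); rewrite etaE.
  have h2 : tg * w ^+ 2 <= 1.
    apply: le_trans tgN; rewrite ler_wpM2l// ler_pXn2r// nnegrE ltW//.
  nra.
have Cq : 1 - d ^+ 2 * (u + u ^+ 2) <= cos (a * eta + t * eta ^+ 2).
  apply: le_trans (cos_ge_parabola _).
  rewrite lerD2l lerN2.
  have h1 : (a * eta) ^+ 2 <= d ^+ 2 * u.
    have -> : (a * eta) ^+ 2 = (`|a| * w) ^+ 2 * u.
      by rewrite !exprMn etaE real_normK ?num_real//; ring.
    by rewrite ler_wpM2r// ler_pXn2r// nnegrE// mulr_ge0// ltW.
  have h2 : (t * eta ^+ 2) ^+ 2 <= d ^+ 2 * u ^+ 2.
    rewrite etaE mulrA [(_ * u) ^+ 2]exprMn ler_wpM2r ?sqr_ge0//.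
    by rewrite ler_pXn2r// nnegrE// mulr_ge0// ltW.
  have := sqr_ge0 (a * eta - t * eta ^+ 2); nra.
have h3 : E - d ^+ 2 * (u + u ^+ 2) <= E * cos (a * eta + t * eta ^+ 2).
  apply: (@le_trans _ _ (E * (1 - d ^+ 2 * (u + u ^+ 2)))); last by rewrite ler_wpM2l.
  have : 0 <= d ^+ 2 * (u + u ^+ 2) by rewrite mulr_ge0 ?sqr_ge0// addr_ge0 ?sqr_ge0.
  nra.
apply: le_trans (ler_wpM2r (expR_ge0 _) h3).
rewrite mulrBl lerB//.
  (* The rate 5/2 adds the 2 of the damping to the 1/2 of the packet. *)
  have -> : expR (-2) * expR (- (5 / 2 * u)) = expR (-2 - 2 * u) * expR (- (u / 2)).
    by rewrite -!expRD; congr expR; field.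
  by rewrite ler_wpM2r ?expR_ge0.
have v0 : 0 <= u / 4 by rewrite divr_ge0.
have := modulated_gaussian_le v0.
have -> : 4 * (u / 4) + 16 * (u / 4) ^+ 2 = u + u ^+ 2 by field.
have -> : 2 * (u / 4) = u / 2 by field.
move=> /(ler_wpM2l (sqr_ge0 d)); rewrite mulrA => /le_trans; apply.
by rewrite le_eqVlt; apply/orP; left; apply/eqP; ring.
Qed.

(** The left side is the real part of [e^{-i phi} (p + i q)], which the modulus dominates. *)
Lemma sqrt_sumsq_ge (p q phi : R) :
  cos phi * p + sin phi * q <= Num.sqrt (p ^+ 2 + q ^+ 2).
Proof.
apply: le_trans (ler_norm _) _; rewrite -sqrtr_sqr ler_wsqrtr//.
have := cos2Dsin2 phi; have := sqr_ge0 (sin phi * p - cos phi * q).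
move: (cos phi) (sin phi) => C S h CS.
have -> : p ^+ 2 + q ^+ 2 = (C ^+ 2 + S ^+ 2) * (p ^+ 2 + q ^+ 2) by rewrite CS mul1r.
nra.
Qed.

(** Rotating by the phase at [xi = N] leaves the phase [(y + 2 * t * N) * eta + t * eta ^+ 2] with
    [eta = xi - N]. The real part of the rotated integral is then bounded below pointwise by
    [packet_integrand_ge]. *)
Lemma Pg_abs_packet_ge gamma N w d t y : 0 < w -> w <= N ->
  t `^ gamma * N ^+ 2 <= 1 -> `|y + 2 * t * N| * w <= d ->
  0 <= t -> t * w ^+ 2 <= d ->
  (2 * pi)^-1 * (packet_amp w * (w * packet_gain d)) <=
  Pg_abs gamma (packet_re N w) (packet_im N w) y t.
Proof.
move=> w0 wN tgN ywd t0 twd.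
have w20 : 0 < w ^+ 2 by rewrite exprn_gt0.
have b0 : 0 < (2 * w ^+ 2)^-1 by rewrite invr_gt0 mulr_gt0.
pose a := packet_amp w; have a0 : 0 < a by exact: packet_amp_gt0.
pose g xi := expR (- ((2 * w ^+ 2)^-1 * (xi - N) ^+ 2)).
pose E xi := expR (- (t `^ gamma) * xi ^+ 2).
pose th xi := y * xi + t * xi ^+ 2.
pose fc xi := E xi * cos (th xi) * g xi.
pose fs xi := E xi * sin (th xi) * g xi.
have mE : measurable_fun setT E.
  by apply: measurableT_comp => //; apply: measurable_funM => //; exact: exprn_measurable.
have mth : measurable_fun setT th.
  apply: measurable_funD; apply: measurable_funM => //; exact: exprn_measurable.
have mg : measurable_fun setT g.
  by have /measurable_int/measurable_EFinP := integrable_gaussian N b0.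
have E1 xi : 0 <= E xi <= 1.
  rewrite expR_ge0/= -expR0 ler_expR mulNr oppr_le0 mulr_ge0 ?sqr_ge0 ?powR_ge0//.
have intc : mu.-integrable setT (EFin \o fc).
  apply: (@integrable_gaussian_bound _ _ N (2 * w ^+ 2)^-1 1) => //.
    apply: measurable_funM => //; apply: measurable_funM => //.
    by apply: measurableT_comp mth; apply: continuous_measurable_fun; exact: continuous_cos.
  move=> xi; rewrite !normrM (ger0_norm (expR_ge0 _)) (ger0_norm (expR_ge0 _)).
  by rewrite ler_wpM2r ?expR_ge0// mulr_ile1 ?cos_max ?normr_ge0 ?expR_ge0//; case/andP: (E1 xi).
have ints : mu.-integrable setT (EFin \o fs).
  apply: (@integrable_gaussian_bound _ _ N (2 * w ^+ 2)^-1 1) => //.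
    apply: measurable_funM => //; apply: measurable_funM => //.
    by apply: measurableT_comp mth; apply: continuous_measurable_fun; exact: continuous_sin.
  move=> xi; rewrite !normrM (ger0_norm (expR_ge0 _)) (ger0_norm (expR_ge0 _)).
  by rewrite ler_wpM2r ?expR_ge0// mulr_ile1 ?sin_max ?normr_ge0 ?expR_ge0//; case/andP: (E1 xi).
have reE : Pg_re gamma (packet_re N w) (packet_im N w) y t =
    (2 * pi)^-1 * (a * Rintegral mu setT fc).
  rewrite /Pg_re -RintegralZl//; congr (_ * _); apply: eq_Rintegral => xi _.
  by rewrite fourier_re_packet// fourier_im_packet// /fc /E /th /g /a; ring.
have imE : Pg_im gamma (packet_re N w) (packet_im N w) y t =
    (2 * pi)^-1 * (a * Rintegral mu setT fs).
  rewrite /Pg_im -RintegralZl//; congr (_ * _); apply: eq_Rintegral => xi _.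
  by rewrite fourier_re_packet// fourier_im_packet// /fs /E /th /g /a; ring.
pose phi := th N.
rewrite /Pg_abs reE imE.
apply: le_trans (sqrt_sumsq_ge _ _ phi).
have -> : cos phi * ((2 * pi)^-1 * (a * Rintegral mu setT fc)) +
    sin phi * ((2 * pi)^-1 * (a * Rintegral mu setT fs)) =
    (2 * pi)^-1 * (a * (cos phi * Rintegral mu setT fc + sin phi * Rintegral mu setT fs)).
  by ring.
rewrite ler_wpM2l ?invr_ge0 ?mulr_ge0 ?pi_ge0// ler_wpM2l ?(ltW a0)//.
rewrite -!RintegralZl// -RintegralD//; try exact: integrable_scale.
pose b1 := 5 / 2 / w ^+ 2; pose b2 := (4 * w ^+ 2)^-1.
have b10 : 0 < b1 by rewrite divr_gt0// divr_gt0.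
have b20 : 0 < b2 by rewrite invr_gt0 mulr_gt0.
pose low xi := expR (-2) * expR (- (b1 * (xi - N) ^+ 2)) -
   64 * d ^+ 2 * expR (- (b2 * (xi - N) ^+ 2)).
have i1 := integrable_scale (expR (-2)) (integrable_gaussian N b10).
have i2 := integrable_scale (64 * d ^+ 2) (integrable_gaussian N b20).
(* The 128 of [packet_gain] is 64 times the 2 in [Num.sqrt (pi / b2) = 2 * w * Num.sqrt pi]. *)
have lowE : Rintegral mu setT low = w * packet_gain d.
  rewrite RintegralB// !RintegralZl//; try exact: integrable_gaussian.
  rewrite !Rintegral_gaussian// /packet_gain.
  have -> : pi / b1 = (2 * pi / 5) * w ^+ 2.
    by rewrite /b1; field; rewrite gt_eqF.
  have -> : pi / b2 = pi * (2 * w) ^+ 2.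
    by rewrite /b2; field; rewrite gt_eqF.
  rewrite (sqrtrM (w ^+ 2)) ?divr_ge0 ?mulr_ge0 ?pi_ge0//.
  rewrite (sqrtrM ((2 * w) ^+ 2)) ?pi_ge0// !sqrtr_sqr.
  rewrite !gtr0_norm ?mulr_gt0//; ring.
rewrite -lowE; apply: le_Rintegral => //.
- exact: (integrableB measurableT i1 i2).
- exact: (integrableD measurableT (integrable_scale (cos phi) intc)
     (integrable_scale (sin phi) ints)).
- move=> xi _.
  have := @packet_integrand_ge (t `^ gamma) N w d t (y + 2 * t * N) (xi - N) w0 wN
    (powR_ge0 _ _) tgN ywd t0 twd.
  rewrite addrCA subrr addr0 => /le_trans; apply.
  have -> : (y + 2 * t * N) * (xi - N) + t * (xi - N) ^+ 2 = th xi - phi.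
    by rewrite /phi /th; ring.
  rewrite cosB /fc /fs le_eqVlt; apply/orP; left; apply/eqP; rewrite -/(E xi) -/(g xi).
  ring.
Qed.

End PacketLowerBound.

(** * Testing the maximal estimate on packets *)

Section MaximalFunction.
Variable R : realType.
Local Notation mu := (@lebesgue_measure R).

Import HBNNSimple.

(* The maximal function is an uncountable supremum, hence the direct appeal to the
   definition of the integral instead of [ge0_le_integral], which wants measurability. *)
Lemma cst_mul_measure_le_integral d (T : measurableType d)
    (m : {measure set T -> \bar R}) (D A : set T) (f : T -> \bar R) (k : R) :
  measurable A -> A `<=` D -> 0 <= k -> (forall x, D x -> (0 <= f x)%E) ->
  (forall x, A x -> (k%:E <= f x)%E) -> (k%:E * m A <= \int[m]_(x in D) f x)%E.
Proof.
move=> mA AD k0 f0 kf.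
rewrite ge0_integralE//; apply: le_ereal_sup_tmp.
(* The simple function [k] times the indicator of [A] is a competitor in the supremum that defines
   the integral. *)
exists (sintegral m (scale_nnsfun (indic_nnsfun R mA) k0)).
  exists (scale_nnsfun (indic_nnsfun R mA) k0) => //= x.
  rewrite patchE mindicE; case: ifPn => [|/negP nDx].
    rewrite inE => Dx; have [Ax|Ax] := boolP (x \in A).
      by rewrite mulr1; apply: kf; rewrite inE in Ax.
    by rewrite mulr0 f0.
  case: (boolP (x \in A)) => [|_]; last by rewrite mulr0.
  by rewrite inE => /AD Dx; exfalso; apply: nDx; rewrite inE.
rewrite -integralT_nnsfun /=.
under eq_integral do rewrite EFinM.
rewrite ge0_integralZl//; last by move=> x _; rewrite lee_fin.
  by rewrite integral_indic// setIT.
by apply/measurable_EFinP; exact: measurable_indic.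
Qed.

Lemma maxnorm_ge (gamma alpha m L : R) (fr fi : R -> R) :
  0 <= m -> 0 <= L <= 1 ->
  (forall x, - L <= x <= 0 -> exists2 t, 0 <= t <= 1 &
     m <= Pg_abs gamma fr fi (Gam alpha x t) t) ->
  ((m * Num.sqrt L)%:E <= maxnorm gamma alpha fr fi)%E.
Proof.
move=> m0 /andP[L0 L1] hm.
have mf x : `[- L, 0]%classic x -> (m%:E <= maxfun gamma alpha fr fi x)%E.
  rewrite /= in_itv/= => /hm[t t01 mt].
  apply: (@le_trans _ _ (Pg_abs gamma fr fi (Gam alpha x t) t)%:E); first by rewrite lee_fin.
  by apply: ereal_sup_ubound; exists t => //; rewrite /= in_itv.
have maxfun_ge0 x : (0 <= maxfun gamma alpha fr fi x)%E.
  apply: (@le_trans _ _ (Pg_abs gamma fr fi (Gam alpha x 0) 0)%:E).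
    by rewrite lee_fin sqrtr_ge0.
  by apply: ereal_sup_ubound; exists 0 => //; rewrite /= in_itv/= lexx ler01.
have h : ((m ^+ 2)%:E * mu `[(- L)%R, 0%R]%classic <=
    \int[mu]_(x in `[(-1)%R, 1%R]) (maxfun gamma alpha fr fi x ^+ 2))%E.
  apply: cst_mul_measure_le_integral => //.
  - by apply: subset_itv; rewrite bnd_simp ?lerN2.
  - by rewrite sqr_ge0.
  - by move=> x _; rewrite expe2 mule_ge0.
  - move=> x /mf mx; rewrite EFin_expe !expe2.
    by rewrite lee_pmul// lee_fin.
rewrite /maxnorm.
have -> : ((m * Num.sqrt L)%:E = ((m ^+ 2 * L)%:E `^ 2^-1)%E).
  rewrite poweR_EFin powR12_sqrt ?mulr_ge0 ?sqr_ge0//.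
  by rewrite sqrtrM ?sqr_ge0// sqrtr_sqr ger0_norm.
apply: gt0_ler_poweR => //.
- by rewrite in_itv/= lee_fin mulr_ge0 ?sqr_ge0// leey.
- rewrite in_itv/= leey andbT; apply: integral_ge0 => x _.
  by rewrite mule_ge0.
apply: le_trans h; rewrite lebesgue_measure_itv/= lte_fin.
(* The measure of an interval is given by cases; the second case is the degenerate [L = 0]. *)
rewrite oppr_lt0; case: ifPn => [_|].
  by rewrite -EFinD add0r opprK -EFinM.
by rewrite -leNgt => L0'; rewrite mule0 lee_fin mulr_ge0_le0 ?sqr_ge0.
Qed.

(** Up to constants, the squared estimate reads [a^2 w^2 L <= a^2 w A] with [a = packet_amp w], and
    [a^2 w] cancels. [K] is fixed before [N], so that [N] may later be taken large. *)
Lemma packet_test (gamma alpha s C d : R) :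
  (forall fr fi : R -> R, schwartz fr -> schwartz fi ->
     (maxnorm gamma alpha fr fi <= (C * Hs_norm s fr fi)%:E)%E) ->
  0 < packet_gain d ->
  exists K : R, forall N w L A, 0 < w -> w <= N -> 0 <= L <= 1 -> 0 <= A ->
  (forall xi, (1 + xi ^+ 2) `^ s <= A * (1 + (xi - N) ^+ 2 / w ^+ 2)) ->
  (forall x, - L <= x <= 0 -> exists2 t, 0 <= t <= 1 &
    [/\ t `^ gamma * N ^+ 2 <= 1, `|Gam alpha x t + 2 * t * N| * w <= d &
        t * w ^+ 2 <= d]) ->
  w * L <= K * A.
Proof.
move=> hC k0.
pose k := (2 * pi)^-1 * packet_gain d.
have kk0 : 0 < k by rewrite mulr_gt0// invr_gt0 mulr_gt0// pi_gt0.
exists (C ^+ 2 * 2 * Num.sqrt (2 * pi) / k ^+ 2) => N w L A w0 wN L01 A0 hA ht.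
have a0 := packet_amp_gt0 w0.
set a := packet_amp w in a0.
have L0 : 0 <= L by case/andP: L01.
have m0 : 0 <= a * w * k by rewrite (mulr_ge0 (mulr_ge0 (ltW a0) (ltW w0)) (ltW kk0)).
have h1 : ((a * w * k * Num.sqrt L)%:E <=
    maxnorm gamma alpha (packet_re N w) (packet_im N w))%E.
  apply: maxnorm_ge => // x /ht[t t01 [t1 t2 t3]]; exists t => //.
  have := Pg_abs_packet_ge w0 wN t1 t2 (andP t01).1 t3.
  by congr (_ <= _); rewrite /k /a; ring.
have := le_trans h1 (hC _ _ (schwartz_packet_re N w0) (schwartz_packet_im N w0)).
rewrite lee_fin => h2.
have h3 : (a * w * k * Num.sqrt L) ^+ 2 <=
    (C * Hs_norm s (packet_re N w) (packet_im N w)) ^+ 2.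
  have l0 : 0 <= a * w * k * Num.sqrt L by rewrite mulr_ge0 ?sqrtr_ge0.
  by rewrite ler_pXn2r// nnegrE// (le_trans l0).
rewrite exprMn sqr_sqrtr// [leRHS]exprMn in h3.
have h4 := le_trans h3 (ler_wpM2l (sqr_ge0 C) (Hs_norm_packet_le w0 A0 hA)).
rewrite -/a in h4.
have k20 : 0 < k ^+ 2 by rewrite exprn_gt0.
have aw0 : 0 < a ^+ 2 * w by rewrite mulr_gt0// exprn_gt0.
rewrite mulrAC ler_pdivlMr// -(ler_pM2l aw0).
by move: h4; congr (_ <= _); ring.
Qed.

End MaximalFunction.

(** * Choice of parameters and bounds on the Sobolev exponent *)

Section NecessaryConditions.
Variable R : realType.
Implicit Types (x y z p s t N T gamma alpha beta : R).

(** As [p <= 1], the power [p] of [2 * z] is at most [2 * z] itself. This passes quadratic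
    comparisons of weights to their powers. *)
Lemma powR_le_double p x y z : 0 <= p <= 1 -> 0 <= x -> 0 <= y -> 1 <= z ->
  x <= 2 * y * z -> x `^ p <= 2 * y `^ p * z.
Proof.
move=> /andP[p0 p1] x0 y0 z1 xyz.
have z0 : 0 <= z by exact: le_trans z1.
apply: (@le_trans _ _ ((y * (2 * z)) `^ p)).
  by apply: ge0_ler_powR; rewrite ?nnegrE// ?mulr_ge0// mulrA (mulrC y).
have -> : 2 * y `^ p * z = y `^ p * (2 * z) by ring.
rewrite powRM ?mulr_ge0// ler_wpM2l ?powR_ge0//.
by apply: ler1_powR => //; lra.
Qed.

Lemma powR_unbounded p x : 0 < p -> exists2 N, 1 <= N & x < N `^ p.
Proof.
move=> p0; pose M := Num.max 1 (x + 1).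
have M1 : 1 <= M by rewrite le_max lexx.
exists (M `^ p^-1).
  by rewrite -(powRr0 M) ler_powR// invr_ge0 ltW.
rewrite -powRrM mulVf ?gt_eqF// powRr1 ?(le_trans ler01)//.
by rewrite (@lt_le_trans _ _ (x + 1)) ?ltrDl// le_max lexx orbT.
Qed.

Lemma powR_within_continuous alpha T : 0 < alpha -> 0 < T ->
  {within `[0, T], continuous (fun t => t `^ alpha)}.
Proof.
move=> a0 T0.
have cp t : 0 < t -> {for t, continuous (fun t => t `^ alpha)}.
  move=> t0; apply: differentiable_continuous; apply/derivable1_diffP.
  by have [] := is_derive1_powR alpha t0.
apply/continuous_within_itvP => //; split.
- by move=> t; rewrite in_itv/= => /andP[t0 _]; exact: cp.
- by rewrite powR0 ?gt_eqF//; exact: powR_cvg0.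
- by apply: cvg_at_left_filter; exact: cp.
Qed.

(** Intermediate value theorem for [h t = 2 N t - t^alpha], as [h 0 = 0] and
    [h T >= N * T >= - x]. *)
Lemma stationary_time alpha N T x : 0 < alpha -> 0 < T -> T `^ alpha <= N * T ->
  - (N * T) <= x <= 0 ->
  exists2 t, 0 <= t <= T & Gam alpha x t + 2 * t * N = 0.
Proof.
move=> a0 T0 TN /andP[x1 x2].
pose h t := 2 * N * t - t `^ alpha.
have ch : {within `[0, T], continuous h}.
  move=> t; apply: cvgB; last exact: powR_within_continuous.
  by apply: continuous_subspaceT => u; apply: cvgM; [exact: cvg_cst|exact: cvg_id].
have h0 : h 0 = 0 by rewrite /h mulr0 powR0 ?subr0// gt_eqF.
have hT : N * T <= h T by rewrite /h; lra.
have [||t] := @IVT _ h 0 T (- x) _ ch; first exact: ltW.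
  by rewrite h0 ge_min le_max; apply/andP; split; apply/orP; [left|right]; lra.
rewrite in_itv/= => t0T ht; exists t => //.
by move: ht; rewrite /h /Gam; lra.
Qed.

Lemma Hs_exponent_ge0 gamma alpha s C : 0 < gamma -> 0 < alpha ->
  (forall fr fi : R -> R, schwartz fr -> schwartz fi ->
     (maxnorm gamma alpha fr fi <= (C * Hs_norm s fr fi)%:E)%E) -> 0 <= s.
Proof.
move=> g0 a0 hC; rewrite leNgt; apply/negP => s0.
have [d /andP[d0 d1] kd] := packet_gain_gt0 R.
have [K hK] := packet_test hC kd.
(* Capping the exponent at 1 makes [powR_le_double] applicable; the weight only grows when [s] is
   replaced by [- p], its base being at least 1. *)
pose p := Num.min (- s) 1.
have p0 : 0 < p by rewrite lt_min oppr_gt0 s0 ltr01.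
have p1 : p <= 1 by rewrite ge_min lexx orbT.
have ps : s <= - p by rewrite lerNr ge_min lexx.
have [N N1 NK] := powR_unbounded (2 * K / d) p0.
have N0 : 0 < N by exact: lt_le_trans N1.
have Y0 : 0 < 1 + N ^+ 2 by rewrite ltr_pwDl// sqr_ge0.
have := hK N 1 d (2 * (1 + N ^+ 2) `^ (- p)) ltr01 N1.
rewrite d1 ltW// => /(_ isT).
rewrite mulr_ge0 ?powR_ge0// => /(_ isT).
have hA xi : (1 + xi ^+ 2) `^ s <=
    2 * (1 + N ^+ 2) `^ (- p) * (1 + (xi - N) ^+ 2 / 1 ^+ 2).
  have X1 : 1 <= 1 + xi ^+ 2 by rewrite lerDl sqr_ge0.
  apply: (le_trans (ler_powR X1 ps)).
  have := @powR_le_double p (1 + N ^+ 2) (1 + xi ^+ 2) (1 + (xi - N) ^+ 2).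
  rewrite p1 ltW// => /(_ isT (ltW Y0) (le_trans ler01 X1)).
  rewrite lerDl sqr_ge0 => /(_ isT).
  (* Peetre's inequality. *)
  have -> : 1 + N ^+ 2 <= 2 * (1 + xi ^+ 2) * (1 + (xi - N) ^+ 2).
    have := sqr_ge0 (2 * xi - N); have := sqr_ge0 (xi * (xi - N)); nra.
  move=> /(_ isT); rewrite !powRN expr1n divr1.
  have X0 : 0 < (1 + xi ^+ 2) `^ p by rewrite powR_gt0// (lt_le_trans ltr01).
  have Yp : 0 < (1 + N ^+ 2) `^ p by rewrite powR_gt0.
  move: (_ `^ p) X0 (_ `^ p) Yp => X X0 Y Yp h.
  have -> : 2 * Y^-1 * (1 + (xi - N) ^+ 2) =
      2 * X * (1 + (xi - N) ^+ 2) * (X * Y)^-1 by field; rewrite !gt_eqF.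
  have -> : X^-1 = Y * (X * Y)^-1 by field; rewrite !gt_eqF.
  by rewrite ler_wpM2r// invr_ge0 ltW// mulr_gt0.
move=> /(_ hA) h.
(* At [t = 0] and [w = 1] the phase condition is [|x| <= d], which dictates the length [d]. *)
have : 1 * d <= K * (2 * (1 + N ^+ 2) `^ (- p)).
  apply: h => x /andP[xd x0]; exists 0; first by rewrite lexx ler01.
  rewrite /Gam !powR0 ?gt_eqF// subr0 !mulr0 !mul0r addr0 mulr1; split=> //.
  - by rewrite ler_norml xd (le_trans x0)// ltW.
  - exact: ltW.
rewrite mul1r powRN mulrA ler_pdivlMr ?powR_gt0//.
apply/negP; rewrite -ltNge mulrC (mulrC d) -ltr_pdivrMr// mulrC.
rewrite (mulrC K) in NK *; apply: (lt_le_trans NK).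
apply: ge0_ler_powR; rewrite ?nnegrE ?ltW//.
have := sqr_ge0 (N - 1); nra.
Qed.

Lemma Hs_exponent_lower_bound gamma alpha beta s C : 0 < alpha ->
  1 <= beta <= 2 -> beta <= gamma -> 2 * (1 - alpha) <= beta ->
  (forall fr fi : R -> R, schwartz fr -> schwartz fi ->
     (maxnorm gamma alpha fr fi <= (C * Hs_norm s fr fi)%:E)%E) ->
  2^-1 * (1 - beta^-1) <= s.
Proof.
move=> a0 /andP[b1 b2] bg ab hC.
have b0 : 0 < beta by exact: lt_le_trans b1.
have g0 : 0 < gamma by exact: lt_le_trans bg.
have s0 := Hs_exponent_ge0 g0 a0 hC.
rewrite leNgt; apply/negP => sb.
have ib0 : 0 < beta^-1 by rewrite invr_gt0.
have ib1 : beta^-1 <= 1 by rewrite invf_le1.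
have s1 : s <= 1 by lra.
have [d /andP[d0 d1] kd] := packet_gain_gt0 R.
have [K hK] := packet_test hC kd.
(* The negated conclusion makes this exponent positive, so its power of [N] can exceed any
   constant. *)
have p0 : 0 < 1 - beta^-1 - 2 * s by lra.
have [N N1 NK] := powR_unbounded (4 * `|K| / d) p0.
have N0 : 0 < N by exact: lt_le_trans N1.
have Nn0 : N != 0 by rewrite gt_eqF.
have pow_le1 e : e <= 0 -> N `^ e <= 1 by move=> /(ler_powR N1); rewrite powRr0.
pose T := N `^ (- (2 / beta)).
have T0 : 0 < T by rewrite powR_gt0.
have T1 : T <= 1 by rewrite pow_le1// oppr_le0 divr_ge0 ?ltW.
have NE : N = N `^ 1 by rewrite powRr1// ltW.
have LE : N * T = N `^ (1 - 2 / beta).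
  by rewrite {1}NE /T -powRD// Nn0 implybT.
have L1 : N * T <= 1.
  have b21 : 1 <= 2 / beta by rewrite ler_pdivlMr// mul1r.
  by rewrite LE pow_le1// subr_le0.
have W0 : 0 < N `^ beta^-1 by rewrite powR_gt0.
have W1 : N `^ beta^-1 <= N by rewrite ler1_powR.
have w0 : 0 < d * N `^ beta^-1 by rewrite mulr_gt0.
have wN : d * N `^ beta^-1 <= N.
  by rewrite (le_trans _ W1)// ler_piMl// ltW.
(* Comparing exponents of [N], this is the hypothesis [2 * (1 - alpha) <= beta]. *)
have TaN : T `^ alpha <= N * T.
  rewrite LE /T -powRrM ler_powR// -subr_ge0.
  have -> : 1 - 2 / beta - - (2 / beta) * alpha = (beta - 2 * (1 - alpha)) / beta.
    by field; rewrite gt_eqF.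
  by rewrite divr_ge0 ?subr_ge0// ltW.
have N2E : N ^+ 2 = N `^ 2 by rewrite powR_mulrn// ltW.
have TgN : T `^ gamma * N ^+ 2 <= 1.
  rewrite N2E /T -powRrM -powRD ?Nn0 ?implybT// pow_le1//.
  have -> : - (2 / beta) * gamma + 2 = - (2 * (gamma - beta) / beta).
    by field; rewrite gt_eqF.
  by rewrite oppr_le0 divr_ge0 ?mulr_ge0 ?subr_ge0// ltW.
(* With the extra factor [d] in the width, [t * w ^+ 2 <= d ^+ 2 <= d] for all [t <= T]. *)
have TW : T * N `^ beta^-1 ^+ 2 = 1.
  rewrite -(powR_mulrn 2 (ltW W0)) -powRrM /T -powRD ?Nn0 ?implybT//.
  by rewrite (mulrC beta^-1) addNr powRr0.
(* Rests on [xi ^+ 2 <= 2 * N ^+ 2 + 2 * (xi - N) ^+ 2] and on [w <= N], which lets the deviation be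
   measured in units of [w]. *)
have hA xi : (1 + xi ^+ 2) `^ s <= 2 * (1 + N ^+ 2) `^ s *
    (1 + (xi - N) ^+ 2 / (d * N `^ beta^-1) ^+ 2).
  set w := d * _ in w0 wN *.
  have u0 : 0 <= (xi - N) ^+ 2 / w ^+ 2 by rewrite divr_ge0 ?sqr_ge0.
  apply: powR_le_double; rewrite ?s0 ?addr_ge0 ?sqr_ge0// ?lerDl//.
  have h1 : (xi - N) ^+ 2 <= N ^+ 2 * ((xi - N) ^+ 2 / w ^+ 2).
    rewrite mulrCA ler_peMr ?sqr_ge0// ler_pdivlMr ?exprn_gt0// mul1r.
    by rewrite ler_pXn2r// nnegrE ltW.
  have := sqr_ge0 (xi - 2 * N); nra.
have := hK N (d * N `^ beta^-1) (N * T) (2 * (1 + N ^+ 2) `^ s) w0 wN.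
rewrite L1 mulr_ge0 ?(ltW N0) ?(ltW T0)// => /(_ isT).
rewrite mulr_ge0 ?powR_ge0// => /(_ isT hA) h.
have {}h : d * N `^ beta^-1 * (N * T) <= K * (2 * (1 + N ^+ 2) `^ s).
  apply: h => x xL.
  have [t /andP[t0 tT] tE] := stationary_time a0 T0 TaN xL.
  exists t; first by rewrite t0 (le_trans tT).
  split.
  - apply: le_trans TgN; rewrite ler_wpM2r ?sqr_ge0//.
    by apply: ge0_ler_powR; rewrite ?nnegrE// ltW.
  - by rewrite tE normr0 mul0r ltW.
  - rewrite (@le_trans _ _ (T * (d * N `^ beta^-1) ^+ 2)) ?ler_wpM2r ?sqr_ge0//.
    by rewrite exprMn mulrCA TW mulr1 expr2 ler_piMl// ltW.
(* The sign of [K] is unknown, hence the absolute value; the second factor 2 comes from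
   [1 + N ^+ 2 <= 2 * N ^+ 2]. *)
have h1 : K * (2 * (1 + N ^+ 2) `^ s) <= 4 * `|K| * N `^ (2 * s).
  apply: (@le_trans _ _ (`|K| * (2 * (1 + N ^+ 2) `^ s))).
    by rewrite ler_wpM2r ?ler_norm// mulr_ge0 ?powR_ge0.
  have -> : 4 * `|K| * N `^ (2 * s) = `|K| * (2 * (2 * N `^ (2 * s) * 1)) by ring.
  rewrite ler_wpM2l// ler_wpM2l// powRrM -N2E.
  apply: powR_le_double; rewrite ?s0 ?addr_ge0 ?sqr_ge0//.
  have : 1 <= N ^+ 2 by rewrite exprn_ege1.
  lra.
have := le_trans h h1; apply/negP; rewrite -ltNge.
have -> : d * N `^ beta^-1 * (N * T) = d * N `^ (1 - beta^-1 - 2 * s) * N `^ (2 * s).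
  rewrite LE -!mulrA -!powRD ?Nn0 ?implybT//; congr (d * _ `^ _).
  by field; rewrite gt_eqF.
by rewrite ltr_pM2r ?powR_gt0// (mulrC d) -ltr_pdivrMr.
Qed.

End NecessaryConditions.

Theorem theorem3p2 (R : realType) (gamma alpha s : R)
  (hgamma : 1 <= gamma) (halpha1 : 4^-1 < alpha) (halpha2 : alpha <= 1) :
  (exists C : R, forall fr fi : R -> R, schwartz fr -> schwartz fi ->
     (maxnorm gamma alpha fr fi <= (C * Hs_norm s fr fi)%:E)%E) ->
  (Num.max (2 * alpha)^-1 1 <= gamma -> gamma < 2 -> 2^-1 * (1 - gamma^-1) <= s) /\
  (2 <= gamma -> 4^-1 <= s).
Proof.
move=> [C hC]; have a0 : 0 < alpha by apply: lt_trans halpha1; rewrite invr_gt0.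
(* Equivalent to [4 * alpha * (1 - alpha) <= 1]; it turns the lower bound on [gamma] into the
   condition needed for [beta = gamma]. *)
have aa : 2 * (1 - alpha) <= (2 * alpha)^-1.
  rewrite -[leRHS]mul1r ler_pdivlMr ?mulr_gt0//.
  have := sqr_ge0 (2 * alpha - 1); nra.
split=> [hg g2|g2].
  have hg' : (2 * alpha)^-1 <= gamma by apply: le_trans hg; rewrite le_max lexx.
  apply: (Hs_exponent_lower_bound a0 _ (lexx gamma) (le_trans aa hg') hC).
  by rewrite hgamma ltW.
(* The bound for [beta = 2]. *)
have -> : 4^-1 = 2^-1 * (1 - 2^-1) :> R by field.
apply: (Hs_exponent_lower_bound a0 _ g2 _ hC); first by rewrite lexx ler1n.
lra.
Qed.
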